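(* Let $\mathcal B$ be a nondegenerate symmetric left-invariant bilinear form on a perm algebra $(A,\circ_A)$. Define multiplications $\triangleleft_A,\triangleright_A:A\otimes A\to A$ by $$\mathcal B(x\triangleleft_A y,z)=-\mathcal B(x,z\circ_A y),\qquad x\triangleright_A y=x\circ_A y-x\triangleleft_A y,\qquad\forall x,y,z\in A.$$ Then $(A,\triangleright_A,\triangleleft_A,\mathcal B)$ is a quadratic special apre-perm algebra. Conversely, let $(A,\triangleright_A,\triangleleft_A,\mathcal B)$ be a quadratic special apre-perm algebra. Then $\mathcal B$ is left-invariant on the associated perm algebra $(A,\circ_A)$. Hence there is a one-to-one correspondence between perm algebras with nondegenerate symmetric left-invariant bilinear forms and quadratic special apre-perm algebras.
   Context: All vector spaces and algebras are finite-dimensional over an algebraically closed field $\mathbb K$ of characteristic zero. A perm algebra $(A,\circ_A)$ is a vector space with a bilinear operation satisfying $x\circ_A(y\circ_A z)=(x\circ_A y)\circ_A z=(y\circ_A x)\circ_A z$. A bilinear form $\mathcal B$ on it is left-invariant if $\mathcal B(x\circ_A y,z)=\mathcal B(y,x\circ_A z)$ for all $x,y,z$. An apre-perm algebra is a vector space $A$ with multiplications $\triangleright_A,\triangleleft_A:A\otimes A\to A$ such that, setting $x\circ_A y=x\triangleright_A y+x\triangleleft_A y$ and $x\bullet_A y=x\triangleright_A y+y\triangleleft_A x$, $(A,\circ_A)$ is a perm algebra (the associated perm algebra) and for all $x,y,z\in A$: $(x\circ_A y)\bullet_A z=x\bullet_A(y\bullet_A z)=y\bullet_A(x\bullet_A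 z)$ and $z\triangleleft_A(x\circ_A y)=-(z\triangleleft_A y)\triangleleft_A x=x\bullet_A(z\triangleleft_A y)=(x\bullet_A z)\triangleleft_A y$. It is special if $\triangleleft_A$ is commutative. A symmetric bilinear form $\mathcal B$ on a special apre-perm algebra is invariant if $\mathcal B(x\triangleleft_A y,z)=-\mathcal B(x,z\circ_A y)$ for all $x,y,z$. A quadratic special apre-perm algebra $(A,\triangleright_A,\triangleleft_A,\mathcal B)$ is a special apre-perm algebra with a nondegenerate symmetric invariant bilinear form. *)

(* Defs.v *)
From HB Require Import structures.
From mathcomp Require Import all_boot all_order all_algebra.

Set Implicit Arguments.
Unset Strict Implicit.
Unset Printing Implicit Defensive.

Import GRing.Theory.
Local Open Scope ring_scope.

Section AprePerm.
Variables (K : fieldType) (A : vectType K).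
Implicit Types (mul tr tl : {bilinear A -> A -> A}) (B : {symmetric A}).

Definition is_perm mul : Prop :=
  forall x y z : A,
    mul x (mul y z) = mul (mul x y) z /\ mul (mul x y) z = mul (mul y x) z.

Definition left_invariant mul (B : A -> A -> K) : Prop :=
  forall x y z : A, B (mul x y) z = B y (mul x z).

(* Throughout, tr x y stands for x |> y and tl x y for x <| y. *)

Definition assoc_mul tr tl (x y : A) : A := tr x y + tl x y.

Lemma assoc_mul_is_bilinear tr tl :
  bilinear_for (GRing.Scale.Law.clone _ _ *:%R _)
    (GRing.Scale.Law.clone _ _ *:%R _) (assoc_mul tr tl).
Proof.
by split=> u a x y /=; rewrite /assoc_mul ?linearPl ?linearPr scalerDr addrACA.
Qed.

HB.instance Definition _ tr tl :=
  bilinear_isBilinear.Build K A A A *:%R *:%R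
    (assoc_mul tr tl) (assoc_mul_is_bilinear tr tl).

Definition bullet tr tl (x y : A) : A := tr x y + tl y x.

Record is_apre_perm tr tl : Prop := IsAprePerm {
  apre_perm_assoc : is_perm (assoc_mul tr tl);
  apre_perm_bullet : forall x y z : A,
    bullet tr tl (assoc_mul tr tl x y) z = bullet tr tl x (bullet tr tl y z) /\
    bullet tr tl x (bullet tr tl y z) = bullet tr tl y (bullet tr tl x z);
  apre_perm_tl : forall x y z : A,
    [/\ tl z (assoc_mul tr tl x y) = - tl (tl z y) x,
        - tl (tl z y) x = bullet tr tl x (tl z y)
      & bullet tr tl x (tl z y) = tl (bullet tr tl x z) y]
}.

Record is_special_apre_perm tr tl : Prop := IsSpecialAprePerm {
  special_apre_perm : is_apre_perm tr tl;
  special_tlC : commutative tl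
}.

Definition invariant tr tl B : Prop :=
  forall x y z : A, B (tl x y) z = - B x (assoc_mul tr tl z y).

Record is_quadratic tr tl B : Prop := IsQuadratic {
  quadratic_special : is_special_apre_perm tr tl;
  quadratic_nondeg : nondegenerate B;
  quadratic_invariant : invariant tr tl B
}.

(* The defining equations of <| and |> in terms of the perm product and the
   form; tr and tl are arbitrary maps, not assumed bilinear. *)
Definition induced_by mul B (tr tl : A -> A -> A) : Prop :=
  (forall x y z : A, B (tl x y) z = - B x (mul z y)) /\
  (forall x y : A, tr x y = mul x y - tl x y).

End AprePerm.

(* Structures on a fixed vector space A; equality is equality of the
   operations and of the form, not isomorphism. *)

Record perm_with_form (K : fieldType) (A : vectType K) := PermWithForm {
  pf_mul : {bilinear A -> A -> A};
  pf_form : {symmetric A};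
  pf_perm : is_perm pf_mul;
  pf_nondeg : nondegenerate pf_form;
  pf_left_invariant : left_invariant pf_mul pf_form
}.

Record quadratic_special_apre_perm (K : fieldType) (A : vectType K) :=
  QuadraticSpecialAprePerm {
  qs_tr : {bilinear A -> A -> A};
  qs_tl : {bilinear A -> A -> A};
  qs_form : {symmetric A};
  qs_quadratic : is_quadratic qs_tr qs_tl qs_form
}.

(* Main.v *)
Require Import Defs.
From HB Require Import structures.
From mathcomp Require Import all_boot all_order all_algebra.
From mathcomp Require boolp.

Set Implicit Arguments.
Unset Strict Implicit.
Unset Printing Implicit Defensive.

Import GRing.Theory.
Local Open Scope ring_scope.

(** The defining equation of [<|] says that the right multiplication [_ <| y]
    is minus the [B]-adjoint of [_ o y]. A nondegenerate form on a
    finite-dimensional space identifies the space with its dual, so the adjoint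
    exists, is unique and depends linearly on everything in sight; this gives
    the bilinear product [<|] and its uniqueness ([induced_byP],
    [induced_by_uniq]).

    Left-invariance of [B] for [o] is equivalent to commutativity of [<|], since
    [B (x <| y) z = - B x (z o y)] and [B (y <| x) z = - B y (z o x)]. This is
    used in both directions. From commutativity [x |> y + y <| x] is just
    [x o y], so the identities for the bullet product are those of the perm
    algebra. Each of the four terms in the identities for [<|], once paired with
    a vector [w] and moved across [B], becomes [- B z] of a bracketing of [x],
    [w] and [y] which ends in [y]; the perm identities say that all of these
    agree ([induced_by_quadratic]).

    Passing from [o] to [(|>, <|)] and summing back are mutually inverse by the
    equation [x |> y = x o y - x <| y] in one direction and by uniqueness of the
    induced products in the other; equality of bundled structures reduces to
    pointwise equality of operations by functional extensionality and
    irrelevance of proofs. *)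

(** * Nondegenerate symmetric forms and adjoints *)

Section Adjoint.
Variables (K : fieldType) (A : vectType K) (B : {symmetric A}).

Lemma symmetric_formC x y : B x y = B y x.
Proof. by rewrite hermC expr0 mul1r. Qed.

Lemma nondegenerate_eq0 : nondegenerate B ->
  forall x, (forall z, B x z = 0) -> x = 0.
Proof.
move=> /eqP radB0 x Bx0; apply/eqP; rewrite -memv0 -radB0.
by apply/mem_orthovP => z _; apply: Bx0.
Qed.

Lemma nondegenerate_inj : nondegenerate B ->
  forall x y, (forall z, B x z = B y z) -> x = y.
Proof.
move=> ndB x y Bxy; apply/eqP; rewrite -subr_eq0; apply/eqP.
by apply: (nondegenerate_eq0 ndB) => z; rewrite linearBl /= Bxy subrr.
Qed.

Definition to_dual (x : A) : 'Hom(A, K^o) := linfun (applyr B x : A -> K^o).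

Lemma to_dualE x z : to_dual x z = B x z.
Proof. by rewrite lfunE symmetric_formC. Qed.

Lemma to_dual_is_linear : linear to_dual.
Proof.
move=> a x y; apply/lfunP => z.
by rewrite add_lfunE scale_lfunE !to_dualE linearPl.
Qed.

HB.instance Definition _ := GRing.isLinear.Build K A 'Hom(A, K^o) _ to_dual
  to_dual_is_linear.

(** On a finite-dimensional space, injectivity of [to_dual] already makes it
    bijective; the inverse below is the Riesz representative. *)
Lemma to_dual_surj : nondegenerate B ->
  cancel (linfun to_dual)^-1%VF (linfun to_dual).
Proof.
move=> ndB.
have ker0 : lker (linfun to_dual) == 0%VS.
  apply/lker0P => x y; rewrite !lfunE /= => /lfunP eqxy.
  by apply: (nondegenerate_inj ndB) => z; rewrite -!to_dualE.
have dimE : \dim (limg (linfun to_dual)) = \dim {: 'Hom(A, K^o)}.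
  rewrite limg_dim_eq ?(eqP ker0) ?capv0 // !dimvf.
  (* The dimension of [Hom(A, K)] unfolds to [dim A * 1]. *)
  by rewrite [RHS]muln1.
move=> phi; apply: limg_lfunVK.
suff -> : limg (linfun to_dual) = fullv by apply: memvf.
by apply/eqP; rewrite eqEdim subvf dimE leqnn.
Qed.

(** Defined without assuming nondegeneracy (the partial inverse of a linear map
    is total), so that bilinearity of the induced products holds outright. *)
Definition adjoint (f : 'End(A)) (x : A) : A :=
  ((linfun to_dual)^-1 (to_dual x \o f))%VF.

Lemma adjointP (f : 'End(A)) : nondegenerate B ->
  forall x z, B (adjoint f x) z = B x (f z).
Proof.
move=> ndB x z; rewrite -to_dualE.
have -> : to_dual (adjoint f x) = linfun to_dual (adjoint f x) by rewrite lfunE.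
by rewrite /adjoint to_dual_surj // comp_lfunE to_dualE.
Qed.

Lemma adjoint_linear f : linear (adjoint f).
Proof.
by move=> a x y; rewrite /adjoint linearP comp_lfunDl -comp_lfunZl linearP.
Qed.

Lemma adjoint_linear_op x : linear (adjoint ^~ x).
Proof.
by move=> a f g; rewrite /adjoint comp_lfunDr -comp_lfunZr linearP.
Qed.

End Adjoint.

(** * The products induced by a form *)

Section Induced.
Variables (K : fieldType) (A : vectType K).
Variables (mul : {bilinear A -> A -> A}) (B : {symmetric A}).

Definition rmul (y : A) : 'End(A) := linfun (applyr mul y).

Lemma rmul_linear : linear rmul.
Proof.
move=> a x y; apply/lfunP => z.
by rewrite add_lfunE scale_lfunE !lfunE /= linearPr.
Qed.

Definition induced_tl (x y : A) : A := - adjoint B (rmul y) x.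

Lemma induced_tl_is_bilinear :
  bilinear_for (GRing.Scale.Law.clone _ _ *:%R _)
    (GRing.Scale.Law.clone _ _ *:%R _) induced_tl.
Proof.
split=> u a x y /=; rewrite /induced_tl.
  by rewrite adjoint_linear opprD scalerN.
by rewrite rmul_linear adjoint_linear_op opprD scalerN.
Qed.

HB.instance Definition _ :=
  bilinear_isBilinear.Build K A A A *:%R *:%R induced_tl
    induced_tl_is_bilinear.

Definition induced_tr (x y : A) : A := mul x y - induced_tl x y.

Lemma induced_tr_is_bilinear :
  bilinear_for (GRing.Scale.Law.clone _ _ *:%R _)
    (GRing.Scale.Law.clone _ _ *:%R _) induced_tr.
Proof.
by split=> u a x y /=;
  rewrite /induced_tr ?linearPl ?linearPr scalerBr opprD addrACA.
Qed.

HB.instance Definition _ :=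
  bilinear_isBilinear.Build K A A A *:%R *:%R induced_tr
    induced_tr_is_bilinear.

Lemma induced_byP : nondegenerate B -> induced_by mul B induced_tr induced_tl.
Proof.
by move=> ndB; split=> // x y z; rewrite linearNl /= adjointP // lfunE.
Qed.

Lemma induced_by_uniq (tr tl tr' tl' : A -> A -> A) : nondegenerate B ->
  induced_by mul B tr tl -> induced_by mul B tr' tl' ->
  tr' =2 tr /\ tl' =2 tl.
Proof.
move=> ndB [tlP trP] [tlP' trP'].
have tlE : tl' =2 tl.
  by move=> x y; apply: (nondegenerate_inj ndB) => z; rewrite tlP tlP'.
by split=> // x y; rewrite trP trP' tlE.
Qed.

Lemma assoc_mul_induced (tr tl : {bilinear A -> A -> A}) :
  induced_by mul B tr tl -> assoc_mul tr tl =2 mul.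
Proof. by move=> [_ trP] x y; rewrite /assoc_mul trP subrK. Qed.

Lemma induced_tlC (tr tl : A -> A -> A) : nondegenerate B ->
  left_invariant mul B -> induced_by mul B tr tl -> commutative tl.
Proof.
move=> ndB invB [tlP _] x y; apply: (nondegenerate_inj ndB) => z.
by rewrite !tlP -invB symmetric_formC.
Qed.

Lemma induced_by_quadratic (tr tl : {bilinear A -> A -> A}) :
  is_perm mul -> nondegenerate B -> left_invariant mul B ->
  induced_by mul B tr tl -> is_quadratic tr tl B.
Proof.
move=> permA ndB invB indB.
have mulE := assoc_mul_induced indB.
have tlC := induced_tlC ndB invB indB.
have [tlP trP] := indB.
have bulE x y : bullet tr tl x y = mul x y by rewrite /bullet tlC trP subrK.
have mulA x y z : mul x (mul y z) = mul (mul x y) z by case: (permA x y z).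
have mulCl x y z : mul (mul x y) z = mul (mul y x) z by case: (permA x y z).
split=> //; last by move=> x y z; rewrite tlP mulE.
split=> //; split.
- by move=> x y z; rewrite /= !mulE; apply: permA.
- by move=> x y z; rewrite !bulE !mulE !mulA; split=> //; apply: mulCl.
- move=> x y z; rewrite !bulE mulE; split;
    apply: (nondegenerate_inj ndB) => w.
  + by rewrite linearNl /= !tlP opprK mulA.
  + by rewrite linearNl /= invB !tlP opprK mulCl.
  + by rewrite invB !tlP invB mulA.
Qed.

End Induced.

(** * From quadratic structures back to perm algebras *)

Lemma quadratic_induced (K : fieldType) (A : vectType K)
    (tr tl : {bilinear A -> A -> A}) (B : {symmetric A}) :
  is_quadratic tr tl B -> induced_by (assoc_mul tr tl) B tr tl.
Proof. by case=> _ _ invB; split=> // x y; rewrite /assoc_mul addrK. Qed.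

Lemma quadratic_left_invariant (K : fieldType) (A : vectType K)
    (tr tl : {bilinear A -> A -> A}) (B : {symmetric A}) :
  is_quadratic tr tl B -> left_invariant (assoc_mul tr tl) B.
Proof.
case=> -[_ tlC] _ invB x y z.
by rewrite symmetric_formC -[LHS]opprK -invB tlC invB opprK.
Qed.

(** * The correspondence *)

Section Extensionality.
Variables (K : fieldType) (A : vectType K).

Lemma bilinear_ext (f g : {bilinear A -> A -> A}) : f =2 g -> f = g.
Proof.
case: f g => [f [[f1 f2 f3 f4]]] [g [[g1 g2 g3 g4]]] /= eqfg.
have {eqfg} eqfg : f = g by do 2!apply: boolp.funext => ?; apply: eqfg.
case: _ / eqfg g1 g2 g3 g4 => g1 g2 g3 g4.
by do 2!congr (_ _); congr (isBilinear.Axioms_ _ _ _ _ _ _ _ _ _ _);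
  apply: boolp.Prop_irrelevance.
Qed.

Lemma perm_with_form_ext (P Q : perm_with_form A) :
  pf_mul P =2 pf_mul Q -> pf_form P = pf_form Q -> P = Q.
Proof.
case: P Q => [m B p n l] [m' B' p' n' l'] /= /bilinear_ext eqm eqB.
case: _ / eqm p' l' => p' l'; case: _ / eqB n' l' => n' l'.
by congr PermWithForm; apply: boolp.Prop_irrelevance.
Qed.

Lemma quadratic_special_apre_perm_ext (P Q : quadratic_special_apre_perm A) :
  qs_tr P =2 qs_tr Q -> qs_tl P =2 qs_tl Q -> qs_form P = qs_form Q -> P = Q.
Proof.
case: P Q => [r l B p] [r' l' B' p'] /= /bilinear_ext eqr /bilinear_ext eql eqB.
case: _ / eqr p'; case: _ / eql; case: _ / eqB => p'.
by congr QuadraticSpecialAprePerm; apply: boolp.Prop_irrelevance.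
Qed.

Definition quadratic_of_perm (P : perm_with_form A) :
    quadratic_special_apre_perm A :=
  QuadraticSpecialAprePerm
    (induced_by_quadratic (pf_perm P) (pf_nondeg P) (pf_left_invariant P)
      (induced_byP (pf_mul P) (pf_nondeg P))).

Definition perm_of_quadratic (Q : quadratic_special_apre_perm A) :
    perm_with_form A :=
  PermWithForm
    (apre_perm_assoc
      (special_apre_perm (quadratic_special (qs_quadratic Q))))
    (quadratic_nondeg (qs_quadratic Q))
    (quadratic_left_invariant (qs_quadratic Q)).

Lemma quadratic_of_permK : cancel quadratic_of_perm perm_of_quadratic.
Proof.
move=> P; apply: perm_with_form_ext => //.
exact: assoc_mul_induced (induced_byP (pf_mul P) (pf_nondeg P)).
Qed.

(** The given products of [Q] and those rebuilt from its perm product are both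
    induced by the same data. *)
Lemma perm_of_quadraticK : cancel perm_of_quadratic quadratic_of_perm.
Proof.
move=> Q; have ndB := quadratic_nondeg (qs_quadratic Q).
have [trE tlE] := induced_by_uniq ndB (quadratic_induced (qs_quadratic Q))
  (induced_byP _ ndB).
exact: quadratic_special_apre_perm_ext.
Qed.

End Extensionality.

Theorem proposition3p29 (K : closedFieldType) (charK : [pchar K] =i pred0)
    (A : vectType K) :
  [/\ (forall (mul : {bilinear A -> A -> A}) (B : {symmetric A}),
         is_perm mul -> nondegenerate B -> left_invariant mul B ->
         exists tr tl : {bilinear A -> A -> A},
           [/\ induced_by mul B tr tl,
               (forall tr' tl' : A -> A -> A,
                  induced_by mul B tr' tl' -> tr' =2 tr /\ tl' =2 tl)
             & is_quadratic tr tl B]),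
      (forall (tr tl : {bilinear A -> A -> A}) (B : {symmetric A}),
         is_quadratic tr tl B -> left_invariant (assoc_mul tr tl) B)
    & exists (to_quadratic : perm_with_form A -> quadratic_special_apre_perm A)
             (to_perm : quadratic_special_apre_perm A -> perm_with_form A),
        [/\ (forall P, qs_form (to_quadratic P) = pf_form P /\
               induced_by (pf_mul P) (pf_form P)
                 (qs_tr (to_quadratic P)) (qs_tl (to_quadratic P))),
            (forall Q, pf_form (to_perm Q) = qs_form Q /\
               pf_mul (to_perm Q) =2 assoc_mul (qs_tr Q) (qs_tl Q)),
            cancel to_quadratic to_perm
          & cancel to_perm to_quadratic]].
Proof.
split.
- move=> mul B permA ndB invB.
  exists (induced_tr mul B), (induced_tl mul B).
  have indB := induced_byP mul ndB.
  split=> //; last exact: induced_by_quadratic indB.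
  by move=> tr' tl'; apply: induced_by_uniq indB.
- by move=> tr tl B; apply: quadratic_left_invariant.
- exists (@quadratic_of_perm K A), (@perm_of_quadratic K A).
  split=> //; last 2 first.
  + exact: quadratic_of_permK.
  + exact: perm_of_quadraticK.
  by move=> P; split=> //; apply: induced_byP (pf_nondeg P).
Qed.
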